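(* Let $h\ge 0$, $m\ge 1$ and $\epsilon=\pm1$, and let $(G,D)$ be of type $2^{\bullet h}{:}\operatorname{O}^{\epsilon}_{2m}(2)$. Then the diagram of $(G,D)$ has size $n=2^{h}(2^{2m-1}-\epsilon 2^{m-1})$ and spectrum $$((\,2^h(2^{2m-2}-\epsilon2^{m-1});\ [\epsilon 2^{h+m-1}]^{(2^m-\epsilon)(2^{m-1}-\epsilon)/3},\ [-\epsilon2^{h+m-2}]^{(2^{2m}-4)/3},\ [0]^{\star}\,)).$$
   Context: A normal set $D$ of $3$-transpositions in a group $G$ is a set of elements of order $2$, closed under conjugation, with $|de|\in\{1,2,3\}$ for all $d,e\in D$. The diagram of $D$ is the graph with vertex set $D$ in which two elements are adjacent iff their product has order $3$; its size is $n=|D|$. The spectrum is that of the $(0,1)$-adjacency matrix, written $((k;\dots,[r]^c,\dots))$: first the degree $k$ of the (regular) diagram, counted once, then the remaining eigenvalues, $[r]^c$ meaning $r$ with multiplicity $c$; if listed values coincide, their multiplicities are added, and $[r]^\star$ means that $r$ has whatever further multiplicity (possibly zero) is required for the total multiplicity to be $n$. Let $f$ be a nondegenerate symplectic form on $V=\mathbb{F}_2^{2m}$ and $q:V\to\mathbb{F}_2$ a quadratic form with $f(x,y)=q(x+y)+q(x)+q(y)$, of type $\epsilon=+1$ if maximal totally singular subspaces have dimension $m$ and $\epsilon=-1$ if they have dimension $m-1$. Let $E$ be the set of transvections $x\mapsto x+f(x,v)v$ with $q(v)=1$; $E$ is a normal set of $3$-transpositions in the isometry group of $q$, and $\operatorname{O}^{\epsilon}_{2m}(2)$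 denotes the group generated by $E$ (the full isometry group except in the case $(m,\epsilon)=(2,+1)$). $(G,D)$ is of type $2^{\bullet h}{:}\operatorname{O}^{\epsilon}_{2m}(2)$ if $G$ is a finite group generated by the normal set $D$ of $3$-transpositions and has a normal $2$-subgroup $N$ such that $|D\cap dN|=2^h$ for all $d\in D$ and $(G/N,DN/N)\cong(\operatorname{O}^{\epsilon}_{2m}(2),E)$. (Whether the extension splits plays no role.) *)

(* Defs.v *)
From mathcomp Require Import all_boot all_order all_algebra all_fingroup all_solvable all_field.
From mathcomp Require Import sesquilinear.

Set Implicit Arguments.
Unset Strict Implicit.
Unset Printing Implicit Defensive.

Import GRing.Theory.

Local Open Scope group_scope.

Definition normal_3transpositions (gT : finGroupType) (G D : {set gT}) : Prop :=
  [/\ D \subset G,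
      {in D, forall d, #[d] = 2},
      {in D & G, forall d g, d ^ g \in D} &
      {in D &, forall d e, #[d * e] \in [:: 1%N; 2; 3]}].

Definition diagram (gT : finGroupType) : rel gT := [rel d e | #[d * e] == 3].

Definition regular_graph (T : finType) (e : rel T) (D : {set T}) (k : nat) : Prop :=
  {in D, forall x, #|[set y in D | e x y]| = k}.

Section LinearAlgebra.

Local Open Scope ring_scope.

Definition adjacency (T : finType) (e : rel T) (D : {set T}) : 'M[algC]_#|D| :=
  \matrix_(i, j) (e (enum_val i) (enum_val j))%:R.

(* [s] lists the eigenvalues of [A], each repeated according to multiplicity. *)
Definition has_spectrum (n : nat) (A : 'M[algC]_n) (s : seq algC) : Prop :=
  char_poly A = \prod_(x <- s) ('X - x%:P).

Definition quadratic_form_for (V : vectType 'F_2) (f : V -> V -> 'F_2)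
    (q : V -> 'F_2) : Prop :=
  (forall (a : 'F_2) (x : V), q (a *: x) = a ^+ 2 * q x) /\
  (forall x y : V, f x y = q (x + y) + q x + q y).

Definition totally_singular (V : vectType 'F_2) (q : V -> 'F_2)
    (W : {vspace V}) : Prop :=
  {in W, forall x, q x = 0}.

Definition max_totally_singular (V : vectType 'F_2) (q : V -> 'F_2)
    (W : {vspace V}) : Prop :=
  totally_singular q W /\
  (forall U : {vspace V}, totally_singular q U -> (W <= U)%VS -> U = W).

(* Maximal totally singular subspaces exist, so this is never vacuous. *)
Definition quadratic_type (V : vectType 'F_2) (q : V -> 'F_2)
    (m : nat) (eps : int) : Prop :=
  (eps = 1 /\
    forall W : {vspace V}, max_totally_singular q W -> \dim W = m) \/
  (eps = -1 /\
    forall W : {vspace V}, max_totally_singular q W -> \dim W = m.-1).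

(* Isometries act faithfully on V, so they are taken inside the symmetric group
   on the (finite) set of vectors. *)
Definition transvections (n : nat) (f : 'rV['F_2]_n -> 'rV['F_2]_n -> 'F_2)
    (q : 'rV['F_2]_n -> 'F_2) : {set {perm 'rV['F_2]_n}} :=
  [set s : {perm 'rV['F_2]_n} |
    [exists v, (q v == 1) && [forall x, s x == x + f x v *: v]]].

End LinearAlgebra.

(* (G / N, D N / N) is isomorphic, as a pair, to (<<E>>, E); note that
   [D / N] is the image of D in G / N. *)
Definition orthogonal_type (gT : finGroupType) (h m : nat) (eps : int)
    (G : {group gT}) (D : {set gT}) : Prop :=
  [/\ normal_3transpositions G D,
      <<D>> = G &
      exists (f : {skew_symmetric 'rV['F_2]_(2 * m)}%R)
             (q : 'rV['F_2]_(2 * m) -> 'F_2),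
        [/\ is_psymplectic f,
            quadratic_form_for f q,
            quadratic_type q m eps &
            exists N : {group gT},
              [/\ N <| G,
                  2.-group N,
                  {in D, forall d, #|D :&: d *: N| = (2 ^ h)%N} &
                  exists phi : {morphism G / N >-> {perm 'rV['F_2]_(2 * m)}},
                    isom (G / N) <<transvections f q>> phi /\
                    phi @* (D / N) = transvections f q]]].

(* Main.v *)
Require Import Defs.
From mathcomp Require Import all_boot all_order all_algebra all_fingroup all_solvable all_field.
From mathcomp Require Import sesquilinear.
From mathcomp Require Import ring zify.

(* The diagram of D is a 2^h-fold blow-up (a lexicographic product with a graph
   having no edges) of the graph on S = {v | q v = 1} in which v, w are adjacent
   iff f(v, w) = 1: the kernel of G -> G / N is a 2-group, so it preserves which
   products have order 3, and the transvections of v and w have a product of order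
   3 iff f(v, w) = 1. The adjacency matrix on S is (J - H) / 2, where H is the
   restriction to S of the Fourier matrix (-1)^f(v, w). Let g be the sum of
   (-1)^q(y) over all y. Summing over cosets of a maximal totally singular subspace
   gives g = eps 2^m. The Fourier transform of (-1)^q is g (-1)^q, whence
   H^2 = 2^(2m-1) - (g / 2) H, so H has eigenvalues -g and g / 2, with
   multiplicities determined by its trace; the all-one vector belongs to g / 2.
   Sylvester's identity relating det(y - AB) and det(y - BA) then yields the
   characteristic polynomials of (J - H) / 2 and of its blow-up. *)

Set Implicit Arguments.
Unset Strict Implicit.
Unset Printing Implicit Defensive.

Import GRing.Theory Num.Theory.
Local Open Scope ring_scope.

(** * Determinants and characteristic polynomials *)

Lemma det_scalar_sub_mulC (R : comNzRingType) (m n : nat) (y : R)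
    (A : 'M[R]_(m, n)) (B : 'M[R]_(n, m)) :
  y ^+ n * \det (y%:M - A *m B) = y ^+ m * \det (y%:M - B *m A).
Proof.
(* Both sides come from block eliminations of the same matrix [M]. *)
pose M := block_mx y%:M A B 1%:M.
have dM1 : \det M = \det (y%:M - A *m B).
  have : \det (block_mx 1%:M (- A) 0 1%:M *m M) = \det (y%:M - A *m B).
    rewrite mulmx_block !mul1mx !mul0mx !mulNmx !mulmx1 subrr !add0r.
    by rewrite det_lblock det1 mulr1.
  by rewrite det_mulmx det_ublock !det1 !mul1r.
have : \det (block_mx 1%:M 0 (- B) y%:M *m M) = y ^+ m * \det (y%:M - B *m A).
  rewrite mulmx_block !mul1mx !mul0mx !mulNmx !mulmx1 !addr0.
  rewrite mul_mx_scalar mul_scalar_mx addNr [- _ + _]addrC.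
  by rewrite det_ublock det_scalar.
by rewrite det_mulmx det_lblock det1 mul1r det_scalar dM1.
Qed.

Lemma char_poly_mulmxC (R : comNzRingType) (m n : nat)
    (A : 'M[R]_(m, n)) (B : 'M[R]_(n, m)) :
  'X^n * char_poly (A *m B) = 'X^m * char_poly (B *m A).
Proof.
by rewrite /char_poly /char_poly_mx !map_mxM det_scalar_sub_mulC.
Qed.

(* Adding the rank one matrix [t J] moves the eigenvalue [s] of the all-one
   vector to [s + n t]; the factor [('X - s) ^+ n] can be cancelled in a domain. *)
Lemma char_poly_add_const (R : comNzRingType) (n : nat) (A : 'M[R]_n) (s t : R) :
  A *m const_mx 1 = s *: const_mx 1 :> 'cV_n ->
  ('X - s%:P) ^+ n * (('X - s%:P) * char_poly (A + const_mx t)) =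
  ('X - s%:P) ^+ n * (('X - (s + t *+ n)%:P) * char_poly A).
Proof.
move=> A1.
set y := 'X - s%:P.
pose u : 'cV[{poly R}]_n := const_mx 1.
pose v : 'rV[{poly R}]_n := const_mx t%:P.
have cJ : map_mx polyC (const_mx t : 'M[R]_n) = u *m v.
  by apply/matrixP=> i j; rewrite !mxE big_ord1 !mxE mul1r.
have Mu : char_poly_mx A *m u = y *: u.
  rewrite mulmxBl mul_scalar_mx.
  have -> : map_mx polyC A *m u = s%:P *: u.
    rewrite (_ : u = map_mx polyC (const_mx 1)); last first.
      by apply/matrixP=> i j; rewrite !mxE.
    by rewrite -map_mxM A1 map_mxZ.
  by rewrite scalerBl.
(* Scaling by [y] avoids inverting [char_poly_mx A]: this matrix sends [u] to [y *: u], so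
   [y *: (u *m v)] factors through it. *)
have key : y *: char_poly_mx (A + const_mx t) = char_poly_mx A *m (y%:M - u *m v).
  rewrite mulmxBr mulmxA Mu -scalemxAl mul_mx_scalar -scalerBr.
  by rewrite /char_poly_mx map_mxD cJ opprD addrA.
have d : y ^+ n * char_poly (A + const_mx t) = char_poly A * \det (y%:M - u *m v).
  by rewrite /char_poly -detZ key det_mulmx.
rewrite mulrCA d mulrCA.
(* Exchanging [u] and [v] leaves a determinant of size 1. *)
have := det_scalar_sub_mulC y u v.
rewrite expr1 => ->.
have -> : \det (y%:M - v *m u) = 'X - (s + t *+ n)%:P.
  rewrite det_mx11 !mxE eqxx mulr1n.
  under eq_bigr do rewrite !mxE mulr1.
  by rewrite sumr_const card_ord polyCD polyCMn opprD addrA.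
by ring.
Qed.

(** Every root of the characteristic polynomial has an eigenvector, on which the quadratic relation
    forces the root to be [r] or [s]. Here [b] counts the roots equal to [r] and [c] all others,
    which also covers [r = s]. *)
Lemma char_poly_quadratic (F : closedFieldType) (n : nat) (A : 'M[F]_n) (r s : F) :
  (A - r%:M) *m (A - s%:M) = 0 ->
  exists b c : nat,
    [/\ (b + c)%N = n, \tr A = r *+ b + s *+ c &
        char_poly A = ('X - r%:P) ^+ b * ('X - s%:P) ^+ c].
Proof.
move=> quadA.
have [l defl] := closed_field_poly_normal (char_poly A).
rewrite (monicP (char_poly_monic A)) scale1r in defl.
have sizel : size l = n.
  by apply: succn_inj; rewrite -(size_prod_XsubC l id) -defl size_char_poly.
have l_rs x : x \in l -> (x == r) || (x == s).
  move=> xl; have : root (char_poly A) x by rewrite defl root_prod_XsubC.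
  rewrite -eigenvalue_root_char => /eigenvalueP[v vA v0].
  have vB z : v *m (A - z%:M) = (x - z) *: v.
    by rewrite mulmxBr vA mul_mx_scalar scalerBl.
  have := congr1 (mulmx v) quadA.
  rewrite mulmx0 mulmxA vB -scalemxAl vB scalerA => /eqP.
  by rewrite scaler_eq0 (negPf v0) orbF mulf_eq0 !subr_eq0.
have trl : \tr A = \sum_(x <- l) x.
  (* The trace is read off the coefficient of degree [n - 1], so the empty matrix is treated
     apart. *)
  have [n0|n_gt0] := posnP n.
    rewrite (size0nil (etrans sizel n0)) big_nil /mxtrace big1 // => i.
    by have := ltn_ord i; rewrite {2}n0.
  have := @coefPn_prod_XsubC _ l; rewrite sizel -lt0n -defl => /(_ n_gt0) coefl.
  by apply: oppr_inj; rewrite -coefl char_poly_trace.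
exists (count_mem r l), (count (predC (pred1 r)) l).
rewrite count_predC sizel trl defl; split=> //.
  elim: l l_rs {defl sizel trl} => [|x l IH] l_rs.
    by rewrite big_nil !mulr0n addr0.
  rewrite big_cons IH => [|y yl]; last by apply: l_rs; rewrite inE yl orbT.
  have := l_rs x (mem_head _ _); rewrite /=; case: eqVneq => [->|_] /=.
    by rewrite add1n mulrS addrA add0n.
  by move/eqP=> ->; rewrite add0n add1n mulrS addrCA.
elim: l l_rs {defl sizel trl} => [|x l IH] l_rs.
  by rewrite big_nil !expr0 mulr1.
rewrite big_cons IH => [|y yl]; last by apply: l_rs; rewrite inE yl orbT.
have := l_rs x (mem_head _ _); rewrite /=; case: eqVneq => [->|_] /=.
  by rewrite add1n exprS mulrA add0n.
by move/eqP=> ->; rewrite add0n add1n exprS mulrCA.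
Qed.

(** * Blow-ups of graphs *)

Lemma card_partition_fibers (T U : finType) (D : {set T}) (S : {set U})
    (g : T -> U) (c : nat) (P : pred U) :
  {in D, forall x, g x \in S} ->
  {in S, forall u, #|[set x in D | g x == u]| = c} ->
  #|[set x in D | P (g x)]| = (c * #|[set u in S | P u]|)%N.
Proof.
move=> gS fib.
rewrite -sum1_card (partition_big g (mem [set u in S | P u])) /=; last first.
  by move=> x; rewrite !inE => /andP[/gS -> ->].
rewrite mulnC -sum_nat_const; apply: eq_bigr => u; rewrite inE => /andP[uS Pu].
rewrite -(fib u uS) -sum1_card; apply: eq_bigl => x; rewrite !inE.
by case: eqP => [->|_]; rewrite ?Pu ?andbT ?andbF.
Qed.

(** If [P] is the incidence matrix of points against fibres, the adjacency matrix on [D] is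
    [P A' P^T], with [A'] the one on [S], while [P^T P = c] because the fibres are disjoint of size
    [c]. Moving [P] to the other end gives [c A']. *)
Lemma char_poly_adjacency_fibers (T U : finType) (D : {set T}) (S : {set U})
    (e : rel T) (e' : rel U) (g : T -> U) (c : nat) :
  {in D, forall x, g x \in S} ->
  {in D &, forall x y, e x y = e' (g x) (g y)} ->
  {in S, forall u, #|[set x in D | g x == u]| = c} ->
  'X^#|S| * char_poly (adjacency e D) =
  'X^#|D| * char_poly (c%:R *: adjacency e' S).
Proof.
move=> gS ge fib.
pose P : 'M[algC]_(#|D|, #|S|) := \matrix_(i, j) (g (enum_val i) == enum_val j)%:R.
have PtP : P^T *m P = c%:R%:M.
  apply/matrixP=> i j; rewrite !mxE.
  under eq_bigr => k _ do rewrite !mxE -natrM mulnb.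
  rewrite -natr_sum -mulrnA; congr (_%:R).
  rewrite -(fib (enum_val i) (enum_valP i)).
  case: eqVneq => [<-|ij]; last first.
    rewrite muln0 big1 // => k _; apply/eqP; rewrite eqb0; apply/negP.
    by case/andP=> /eqP -> /eqP /enum_val_inj /eqP; rewrite (negPf ij).
  under eq_bigr do rewrite andbb.
  rewrite muln1 -(big_enum_val (fun x => (g x == enum_val i) : nat)).
  rewrite -sum1_card big_mkcond [RHS]big_mkcond; apply: eq_bigr => x _.
  by rewrite !inE; case: (x \in D); case: eqP.
have AP : adjacency e D = P *m (adjacency e' S *m P^T).
  apply/matrixP=> i j; rewrite !mxE.
  (* [r k] is the only column where row [k] of [P] is nonzero. *)
  pose r (k : 'I_#|D|) := enum_rank_in (gS _ (enum_valP k)) (g (enum_val k)).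
  have rE k : enum_val (r k) = g (enum_val k) by rewrite enum_rankK_in ?gS ?enum_valP.
  rewrite (bigD1 (r i)) //= big1 ?addr0; last first.
    move=> k ki; rewrite !mxE -rE (inj_eq enum_val_inj) eq_sym (negPf ki).
    by rewrite mul0r.
  rewrite !mxE rE eqxx mul1r (bigD1 (r j)) //= big1 ?addr0; last first.
    move=> k kj; rewrite !mxE -(rE j) (inj_eq enum_val_inj) [r j == _]eq_sym (negPf kj).
    by rewrite mulr0.
  by rewrite !mxE !rE eqxx mulr1 ge ?enum_valP.
by rewrite AP char_poly_mulmxC -mulmxA PtP mul_mx_scalar.
Qed.

(** * Quadratic forms over the field of two elements and their Gauss sums *)

Lemma F2_cases (a : 'F_2) : a = 0 \/ a = 1.
Proof. by case: a => [[|[|k]] lk] //; [left | right]; apply: val_inj. Qed.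

Lemma F2_addrr1 : 1 + 1 = 0 :> 'F_2.
Proof. exact: val_inj. Qed.

Definition F2_sign (a : 'F_2) : algC := (-1) ^+ (a : nat).

Lemma F2_sign0 : F2_sign 0 = 1. Proof. by []. Qed.
Lemma F2_sign1 : F2_sign 1 = -1. Proof. by rewrite /F2_sign expr1. Qed.

Lemma F2_signD (a b : 'F_2) : F2_sign (a + b) = F2_sign a * F2_sign b.
Proof.
have [->|->] := F2_cases a; first by rewrite add0r F2_sign0 mul1r.
have [->|->] := F2_cases b; first by rewrite addr0 F2_sign0 mulr1.
by rewrite F2_addrr1 F2_sign0 F2_sign1 mulrNN mulr1.
Qed.

Lemma F2_addrr (n : nat) (x : 'rV['F_2]_n) : x + x = 0.
Proof.
apply/rowP => i; rewrite !mxE.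
by have [->|->] := F2_cases (x 0 i); apply: val_inj.
Qed.

Section QuadraticForm.

Variables (n : nat) (f : {skew_symmetric 'rV['F_2]_n}).
Variable q : 'rV['F_2]_n -> 'F_2.
Hypotheses (f_sympl : is_psymplectic f) (qf : quadratic_form_for f q).

Local Notation V := 'rV['F_2]_n.

Lemma quadratic_form0 : q 0 = 0.
Proof. by rewrite -(scale0r (0 : V)) qf.1 expr0n mul0r. Qed.

Lemma quadratic_formD x y : q (x + y) = q x + q y + f x y.
Proof.
by rewrite qf.2; have [->|->] := F2_cases (q x); have [->|->] := F2_cases (q y);
  have [->|->] := F2_cases (q (x + y)); apply: val_inj.
Qed.

Lemma polar_sym x y : f x y = f y x.
Proof. by rewrite !qf.2 addrAC [y + x]addrC. Qed.

Lemma polar_alternating x : f x x = 0.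
Proof. by case: f_sympl => _ _; apply; rewrite pchar_Fp. Qed.

Lemma polarDr x y z : f x (y + z) = f x y + f x z.
Proof. exact: linearDr. Qed.

Lemma polarZr x a y : f x (a *: y) = a * f x y.
Proof. exact: linearZr. Qed.

Definition q_gauss_sum : algC := \sum_y F2_sign (q y).

(** Orthogonality of characters: if some [z] in [W] has [f x z = 1], translating by [z] negates the
    sum. *)
Lemma sum_F2_sign_polar (W : {vspace V}) x :
  \sum_(y in W) F2_sign (f x y) = #|W|%:R * (x \in orthov f W)%:R.
Proof.
have [/mem_orthovP fx0|/mem_orthovPn[z zW fxz]] := boolP (x \in _).
  rewrite mulr1 -sumr_const.
  by apply: eq_bigr => y /fx0 ->.
have {}fxz : f x z = 1 by case: (F2_cases (f x z)) fxz => ->; rewrite ?eqxx.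
rewrite mulr0; set s := \sum_(_ in _) _.
have sN : s = - s.
  rewrite {1}/s (reindex_inj (addIr z)) -sumrN; apply: eq_big => y.
    by rewrite rpredDr.
  by rewrite polarDr fxz F2_signD F2_sign1 mulrN1.
by apply/eqP; have := mulrn_eq0 s 2; rewrite /= => <-; rewrite mulr2n {1}sN addNr.
Qed.

Lemma mem_orthov_fullv x : (x \in orthov f fullv) = (x == 0).
Proof. by case: f_sympl => /eqP -> _ _; rewrite memv0. Qed.

Lemma sum_F2_sign_polar_setT x :
  \sum_y F2_sign (f x y) = 2 ^+ n * (x == 0)%:R.
Proof.
transitivity (\sum_(y in fullv : {vspace V}) F2_sign (f x y)).
  by apply: eq_bigl => y; rewrite memvf.
rewrite sum_F2_sign_polar mem_orthov_fullv (eq_card (B := V)) => [|y]; last by rewrite memvf.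
by rewrite card_mx mul1n card_Fp // natrX.
Qed.

(** Sum the sign of [f y w] over all [y] and over [w] in [W] in both orders; by nondegeneracy only
    [w = 0] survives when [y] is summed first. *)
Lemma card_mul_orthov (W : {vspace V}) : (#|W| * #|orthov f W| = 2 ^ n)%N.
Proof.
apply/eqP; rewrite -(eqr_nat algC) natrM; apply/eqP.
transitivity (\sum_y \sum_(w in W) F2_sign (f y w)).
  under eq_bigr do rewrite sum_F2_sign_polar.
  rewrite -mulr_sumr; congr (_ * _).
  by rewrite -sumr_const [LHS]big_mkcond; apply: eq_bigr => y _; case: ifP.
rewrite exchange_big /= (bigD1 0) ?mem0v //= [X in _ + X]big1 => [|w /andP[_ /negPf w0]].
  under eq_bigr do rewrite polar_sym.
  by rewrite sum_F2_sign_polar_setT eqxx mulr1 addr0 natrX.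
under eq_bigr do rewrite polar_sym.
by rewrite sum_F2_sign_polar_setT w0 mulr0.
Qed.

Lemma totally_singular_orthov (W : {vspace V}) :
  totally_singular q W -> (W <= orthov f W)%VS.
Proof.
move=> Wq; apply/subvP => x xW; apply/mem_orthovP => y yW.
by rewrite qf.2 !Wq ?memvD // !addr0.
Qed.

Lemma totally_singular_add (W : {vspace V}) y :
  totally_singular q W -> y \in orthov f W -> q y = 0 ->
  totally_singular q (W + <[y]>)%VS.
Proof.
move=> Wq /mem_orthovP yW qy x /memv_addP[w wW [_ /vlineP[a ->] ->]].
by rewrite quadratic_formD Wq // qf.1 qy mulr0 polarZr polar_sym yW // mulr0 !addr0.
Qed.

(** Starting from 0, adjoin singular vectors orthogonal to [W] until all of them lie in [W]. Then
    [W] is maximal, since a totally singular [U] containing [W] is orthogonal to itself and hence to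
    [W]. *)
Lemma exists_max_totally_singular :
  exists2 W : {vspace V}, max_totally_singular q W &
    forall y, y \in orthov f W -> q y = 0 -> y \in W.
Proof.
(* [k] bounds the number of dimensions that [W] can still gain. *)
suff H k : forall W : {vspace V}, totally_singular q W -> (n <= \dim W + k)%N ->
  exists2 W : {vspace V}, totally_singular q W &
    forall y, y \in orthov f W -> q y = 0 -> y \in W.
  have [||W Wq Wmax] := H n 0%VS; last 1 first.
  - exists W => //; split=> // U Uq WU; apply/eqP; rewrite eqEsubv WU andbT.
    apply/subvP => y yU; apply: Wmax; last exact: Uq.
    apply/mem_orthovP => w wW.
    move: (totally_singular_orthov Uq) => /subvP/(_ y yU)/mem_orthovP; apply.
    exact: (subvP WU).
  - by move=> x; rewrite memv0 => /eqP ->; exact: quadratic_form0.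
  - by rewrite leq_addl.
elim: k => [|k IH] W Wq dW; have [/existsP[y /and3P[yWo /eqP qy yW]]|/existsPn closedW] :=
  boolP [exists y : V, [&& y \in orthov f W, q y == 0 & y \notin W]].
2, 4: by exists W => // y yWo qy; have := closedW y; rewrite yWo qy eqxx negbK.
all: have ltW : (\dim W < \dim (W + <[y]>))%N by
  rewrite ltnNge; apply: contra yW => le; have /eqP -> : W == (W + <[y]>)%VS;
    [rewrite eqEdim addvSl | rewrite memvE addvSr].
- have := leq_trans ltW (dimvS (subvf _)); rewrite dimvf /dim /= mul1n.
  by rewrite addn0 in dW; rewrite ltnNge dW.
- apply: (IH (W + <[y]>)%VS); first exact: totally_singular_add.
  by rewrite (leq_trans dW) // addnS -addSn leq_add2r.
Qed.

(* Averaging over translates by [W] kills the terms outside the orthogonal of [W]. *)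
Lemma q_gauss_sum_totally_singular (W : {vspace V}) :
  totally_singular q W ->
  q_gauss_sum = \sum_(y in orthov f W) F2_sign (q y).
Proof.
move=> Wq.
have W0 : #|W|%:R != 0 :> algC.
  by rewrite pnatr_eq0 -lt0n; apply/card_gt0P; exists 0; apply: mem0v.
apply: (mulfI W0).
transitivity (\sum_(w in W) \sum_y F2_sign (q (y + w))).
  rewrite mulr_natl -sumr_const; apply: eq_bigr => w _.
  by rewrite /q_gauss_sum (reindex_inj (addIr w)).
rewrite exchange_big /= mulr_sumr [RHS]big_mkcond; apply: eq_bigr => y _.
under eq_bigr => w wW do rewrite quadratic_formD (Wq w wW) addr0 F2_signD.
rewrite -mulr_sumr sum_F2_sign_polar.
by case: (y \in _); rewrite ?mulr0 // mulr1 mulrC.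
Qed.

(** On the orthogonal of [W] the form vanishes exactly on [W], so the sum is [#|W|] minus the size
    of the complement of [W] there. *)
Lemma q_gauss_sum_max_totally_singular (W : {vspace V}) :
  totally_singular q W -> (forall y, y \in orthov f W -> q y = 0 -> y \in W) ->
  q_gauss_sum = #|W|%:R *+ 2 - #|orthov f W|%:R.
Proof.
move=> Wq Wmax; rewrite (q_gauss_sum_totally_singular Wq).
have WW := subvP (totally_singular_orthov Wq).
rewrite -!sumr_const -sumrMnl.
rewrite [X in _ = X - _](_ : _ = \sum_(y in orthov f W) (y \in W)%:R *+ 2).
  rewrite -sumrB; apply: eq_bigr => y yW; case: (boolP (y \in W)) => [/Wq ->|nyW].
    by rewrite F2_sign0 mulr2n addrK.
  have [qy|->] := F2_cases (q y); first by rewrite (Wmax y) in nyW.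
  by rewrite F2_sign1 mul0rn sub0r.
rewrite big_mkcond [RHS]big_mkcond; apply: eq_bigr => y _.
have := WW y; case: (y \in W) => [->//|_].
by rewrite mul0rn if_same.
Qed.

End QuadraticForm.

Lemma q_gauss_sum_type (m : nat) (eps : int) (f : {skew_symmetric 'rV['F_2]_(2 * m)})
    (q : 'rV['F_2]_(2 * m) -> 'F_2) :
  (0 < m)%N -> is_psymplectic f -> quadratic_form_for f q -> quadratic_type q m eps ->
  q_gauss_sum q = eps%:~R * 2 ^+ m.
Proof.
move=> m_gt0 fS qf qT.
have [W Wm Wc] := exists_max_totally_singular qf.
have := card_mul_orthov fS qf W.
rewrite (q_gauss_sum_max_totally_singular qf Wm.1 Wc) !card_vspace !card_Fp //.
move=> /eqP; rewrite -expnD eqn_exp2l // => /eqP dW.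
have -> : \dim (orthov f W) = (2 * m - \dim W)%N
  by exact: etrans (esym (addKn _ _)) (congr1 (subn^~ _) dW).
have [[-> dm]|[-> dm]] := qT; rewrite dm //.
  by rewrite mul2n -addnn addnK mul1r natrX mulr2n addrK.
(* In the minus case, with [m] lowered by one, [W] has dimension [m] and its orthogonal [m + 2],
   giving [2 ^ (m + 1) - 2 ^ (m + 2)]. *)
clear -m_gt0; case: m m_gt0 => //= m _.
have -> : (2 * m.+1 - m = m.+2)%N by rewrite mul2n -addnn addSnnS addKn.
by rewrite !natrX !exprS; ring.
Qed.

(** * The graph on the nonsingular vectors *)

Section NonsingularVectors.

Variables (n : nat) (f : {skew_symmetric 'rV['F_2]_n}).
Variable q : 'rV['F_2]_n -> 'F_2.
Hypotheses (f_sympl : is_psymplectic f) (qf : quadratic_form_for f q).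

Local Notation V := 'rV['F_2]_n.

Definition nonsingular_vectors : {set V} := [set v | q v == 1].
Definition nonorthogonal : rel V := [rel v w | f v w == 1].

Local Notation S := nonsingular_vectors.
Local Notation g := (q_gauss_sum q).

Lemma nonsingular_neq0 v : v \in S -> v != 0.
Proof.
by rewrite inE; apply: contraTneq => ->; rewrite (quadratic_form0 qf).
Qed.

(** [1 - F2_sign (q v)] is twice the indicator of [S]. *)
Lemma sum_nonsingular (F : V -> algC) :
  (\sum_(v in S) F v) *+ 2 = \sum_v F v - \sum_v F2_sign (q v) * F v.
Proof.
rewrite -sumrMnl -sumrB big_mkcond; apply: eq_bigr => v _; rewrite inE.
have [->|->] := F2_cases (q v); first by rewrite F2_sign0 mul1r subrr.
by rewrite eqxx F2_sign1 mulN1r opprK mulr2n.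
Qed.

(** Completing the square: [q y + f x y = q (x + y) + q x], followed by a shift of the summation
    variable. *)
Lemma sum_F2_sign_quadratic_polar x :
  \sum_y F2_sign (q y) * F2_sign (f x y) = g * F2_sign (q x).
Proof.
rewrite mulrC mulr_sumr [RHS](reindex_inj (addrI x)); apply: eq_bigr => y _.
rewrite -!F2_signD; congr F2_sign; rewrite (quadratic_formD qf).
by have [->|->] := F2_cases (q x); rewrite ?add0r // !addrA F2_addrr1 add0r.
Qed.

Lemma card_nonsingular : #|S|%:R *+ 2 = 2 ^+ n - g.
Proof.
rewrite -sumr_const sum_nonsingular.
rewrite sumr_const card_mx mul1n card_Fp // natrX; congr (_ - _).
by apply: eq_bigr => v _; rewrite mulr1.
Qed.

Lemma sum_polar_nonsingular x :
  (\sum_(v in S) F2_sign (f x v)) *+ 2 = 2 ^+ n * (x == 0)%:R - g * F2_sign (q x).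
Proof.
by rewrite sum_nonsingular (sum_F2_sign_polar_setT f_sympl) sum_F2_sign_quadratic_polar.
Qed.

Lemma nonorthogonalE v w : (nonorthogonal v w)%:R = (1 - F2_sign (f v w)) / 2.
Proof.
rewrite /nonorthogonal /=; have [->|->] := F2_cases (f v w).
  by rewrite F2_sign0 subrr mul0r.
by rewrite F2_sign1 eqxx /=; field.
Qed.

(** The factor 4 clears two halvings, from the indicator of [S] and from that of [f v w = 1]. *)
Lemma degree_nonorthogonal v : v \in S ->
  #|[set w in S | nonorthogonal v w]|%:R *+ 4 = 2 ^+ n - g *+ 2.
Proof.
move=> vS.
rewrite -sum1_card big_mkcond natr_sum.
rewrite (_ : \sum_i _ = \sum_(w in S) (nonorthogonal v w)%:R); last first.
  rewrite [RHS]big_mkcond; apply: eq_bigr => w _; rewrite !inE.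
  by case: (q w == 1); case: (nonorthogonal v w).
under eq_bigr do rewrite nonorthogonalE.
have := sum_polar_nonsingular v.
rewrite (negPf (nonsingular_neq0 vS)) mulr0 -mulr_suml sumrB sumr_const.
move: vS; rewrite inE => /eqP ->; rewrite F2_sign1 mulrN1 => sumE.
transitivity (#|S|%:R *+ 2 - (\sum_(w in S) F2_sign (f v w)) *+ 2); first by field.
by rewrite card_nonsingular sumE; ring.
Qed.

(** The scaled adjacency matrix is [A + (c / 2) J] with [A = - (c / 2) H]; the eigenvalues [-g] and
    [g / 2] of [H] become [r] and [s]. The all-one vector belongs to [s], which moves once to
    [s + (c / 2) N]. The factor ['X - s%:P] stays on the left because [d] is not yet known to be
    positive. *)
Lemma char_poly_nonorthogonal (c : nat) :
  g ^+ 2 = 2 ^+ n ->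
  let N : algC := #|S|%:R in
  let r := c%:R / 2 * g in
  let s := - (c%:R / 4 * g) in
  exists b d : nat,
    [/\ (b + d)%N = #|S|, r *+ b + s *+ d = - (c%:R / 2 * N) &
        ('X - s%:P) * char_poly (c%:R *: adjacency nonorthogonal S) =
        ('X - (s + c%:R / 2 * N)%:P) * (('X - r%:P) ^+ b * ('X - s%:P) ^+ d)].
Proof.
move=> g2 N r s.
pose H : 'M[algC]_#|S| := \matrix_(i, j) F2_sign (f (enum_val i) (enum_val j)).
pose A := - (c%:R / 2) *: H.
have rows x : x \in S -> \sum_(i < #|S|) F2_sign (f x (enum_val i)) = g / 2.
  move=> xS; rewrite -(big_enum_val (fun v => F2_sign (f x v))).
  have := sum_polar_nonsingular x.
  rewrite (negPf (nonsingular_neq0 xS)) mulr0; move: xS; rewrite inE => /eqP ->.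
  rewrite F2_sign1 => E; apply: (mulIf (x := 2)); rewrite ?pnatr_eq0 // mulr_natr E.
  by rewrite divfK ?pnatr_eq0 //; ring.
have A1 : A *m const_mx 1 = s *: const_mx 1 :> 'cV_#|S|.
  apply/colP => i; rewrite !mxE mulr1.
  under eq_bigr do rewrite !mxE mulr1.
  by rewrite -mulr_sumr rows ?enum_valP // /s; field.
(* Rows [i] and [j] multiply to the character of [x], the sum of their vectors, and [q x] is the
   polar value of the pair because both vectors have [q = 1]. *)
have HH : H *m H = (2 ^+ n / 2)%:M - (g / 2) *: H.
  apply/matrixP => i j; rewrite !mxE.
  pose x := enum_val i + enum_val j.
  under eq_bigr do rewrite !mxE [X in _ * F2_sign X](polar_sym qf) -F2_signD.
  have E v : f (enum_val i) v + f (enum_val j) v = f x v.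
    by rewrite ![f _ v](polar_sym qf) (polarDr f).
  under eq_bigr do rewrite E.
  rewrite -(big_enum_val (fun v => F2_sign (f x v))).
  have := sum_polar_nonsingular x.
  have -> : q x = f (enum_val i) (enum_val j).
    rewrite (quadratic_formD qf).
    have := enum_valP i; rewrite inE => /eqP ->.
    have := enum_valP j; rewrite inE => /eqP ->.
    by rewrite F2_addrr1 add0r.
  have -> : (x == 0) = (i == j).
    rewrite -(inj_eq enum_val_inj); apply/eqP/eqP => [x0|ij]; last by rewrite /x ij F2_addrr.
    by rewrite -[LHS]addr0 -(F2_addrr (enum_val j)) addrA -/x x0 add0r.
  move=> E2; apply: (mulIf (x := 2)); rewrite ?pnatr_eq0 // mulr_natr E2.
  by rewrite -mulr_natr; field.
(* Since [g ^ 2 = 2 ^ n], [HH] says that [(H + g) (H - g / 2) = 0]; this is rescaled by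
   [- c / 2]. *)
have quadA : (A - r%:M) *m (A - s%:M) = 0.
  rewrite mulmxBl !mulmxBr mul_scalar_mx -scalar_mxM mul_mx_scalar.
  rewrite /A -scalemxAl -scalemxAr HH.
  by apply/matrixP => i j; rewrite !mxE -g2 /r /s; case: (i == j); rewrite ?mulr1n ?mulr0n; field.
have [b [d [bd trA chA]]] := char_poly_quadratic quadA.
exists b, d; split=> //.
  rewrite -trA /mxtrace; under eq_bigr do rewrite !mxE (polar_alternating f_sympl) F2_sign0 mulr1.
  by rewrite sumr_const card_ord /N -[LHS]mulr_natr mulNr.
have -> : c%:R *: adjacency nonorthogonal S = A + const_mx (c%:R / 2).
  by apply/matrixP => i j; rewrite !mxE nonorthogonalE; field.
rewrite -chA; apply: (mulfI (x := ('X - s%:P) ^+ #|S|)).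
  by rewrite expf_neq0 // polyXsubC_eq0.
by rewrite (char_poly_add_const _ A1) mulr_natr.
Qed.

End NonsingularVectors.

(** * Transvections and the orders of their products *)

Section Transvections.

Variables (n : nat) (f : {skew_symmetric 'rV['F_2]_n}).
Variable q : 'rV['F_2]_n -> 'F_2.
Hypotheses (f_sympl : is_psymplectic f) (qf : quadratic_form_for f q).

Local Notation V := 'rV['F_2]_n.
Local Notation S := (nonsingular_vectors q).

Lemma polarDl x y z : f (x + y) z = f x z + f y z.
Proof. by rewrite ![f _ z](polar_sym qf) (polarDr f). Qed.

Lemma polarZl a x y : f (a *: x) y = a * f x y.
Proof. by rewrite ![f _ y](polar_sym qf) (polarZr f). Qed.

Definition transvection_fun (v x : V) : V := x + f x v *: v.

Lemma transvection_funK v : involutive (transvection_fun v).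
Proof.
move=> x; rewrite /transvection_fun polarDl polarZl (polar_alternating f_sympl).
by rewrite mulr0 addr0 -addrA F2_addrr addr0.
Qed.

Definition transvection v : {perm V} := perm (inv_inj (transvection_funK v)).

Lemma transvectionE v x : transvection v x = x + f x v *: v.
Proof. by rewrite permE. Qed.

Lemma transvectionsE : transvections f q = [set transvection v | v in S].
Proof.
apply/setP => s; rewrite inE; apply/existsP/imsetP => [[v /andP[qv /forallP sv]]|[v vS ->]].
  by exists v; rewrite ?inE //; apply/permP => x; rewrite transvectionE (eqP (sv x)).
by exists v; move: vS; rewrite inE => ->; apply/forallP => x; rewrite transvectionE.
Qed.

(** At some [x] with [f x v = 1], equality of the images gives [v = f x w *: w], and [v] is
    nonzero. *)
Lemma transvection_inj : {in S &, injective transvection}.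
Proof.
move=> v w vS wS /permP vw.
have v0 := nonsingular_neq0 qf vS.
have := v0; rewrite -(mem_orthov_fullv f_sympl) => /mem_orthovPn[x _].
rewrite (polar_sym qf) => fxv.
have {}fxv : f x v = 1 by case: (F2_cases (f x v)) fxv => ->; rewrite ?eqxx.
move: (vw x); rewrite !transvectionE fxv scale1r => /addrI.
case: (F2_cases (f x w)) => ->; last by rewrite scale1r.
by rewrite scale0r => v_0; rewrite v_0 eqxx in v0.
Qed.

(** If [f v w = 0] the two involutions commute, so their product has square 1. If [f v w = 1] they
    satisfy the braid relation, so its cube is 1, and it moves [v] to [v + w]. *)
Lemma order_transvection_mul : {in S &, forall v w,
  (#[transvection v * transvection w]%g == 3%N) = nonorthogonal f v w}.
Proof.
move=> v w vS wS; rewrite /nonorthogonal /=.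
have tt u : (transvection u * transvection u = 1)%g.
  by apply/permP => x; rewrite perm1 permM [LHS]permE permE transvection_funK.
have [fvw|fvw] := F2_cases (f v w).
  have vwC : (transvection v * transvection w = transvection w * transvection v)%g.
    apply/permP => x; rewrite !permM !transvectionE !polarDl !polarZl fvw.
    by rewrite [f w v](polar_sym qf) fvw !mulr0 !addr0 addrAC.
  rewrite fvw; apply/negbTE/negP => /eqP o3.
  have /eqP : ((transvection v * transvection w) ^+ 2 = 1)%g.
    by rewrite expgS expg1 {2}vwC mulgA -(mulgA (transvection v)) tt mulg1 tt.
  by rewrite -order_dvdn o3.
rewrite fvw eqxx; apply/eqP/nt_prime_order => //.
  have braid : (transvection v * transvection w * transvection v =
                transvection w * transvection v * transvection w)%g.
    apply/permP => x; rewrite !permM !transvectionE !(polarDl, polarZl).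
    rewrite [f w v](polar_sym qf) fvw !(polar_alternating f_sympl).
    have [->|->] := F2_cases (f x v); have [->|->] := F2_cases (f x w);
      by rewrite ?(mulr0, mulr1, addr0, add0r, scale0r, scale1r, F2_addrr1) // -!addrA !F2_addrr.
  rewrite 2!expgS expg1 !mulgA braid.
  by rewrite -(mulgA _ (transvection w) (transvection w)) tt mulg1
    -(mulgA _ (transvection v) (transvection v)) tt mulg1 tt.
apply/eqP => /permP/(_ v); rewrite permM !transvectionE (polar_alternating f_sympl).
rewrite scale0r addr0 fvw scale1r perm1 => /eqP.
by rewrite -subr_eq0 addrAC subrr add0r (negPf (nonsingular_neq0 qf wS)).
Qed.

End Transvections.

(** * From the group to its orthogonal quotient *)

(** The order of the image divides that of [x], and an element of order 3 cannot lie in the 2-group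
    [N]. *)
Lemma order3_quotient (gT : finGroupType) (N : {group gT}) (x : gT) :
  (2.-group N)%g -> x \in 'N(N)%g -> #[x]%g \in [:: 1; 2; 3]%N ->
  (#[coset N x]%g == 3%N) = (#[x]%g == 3%N).
Proof.
move=> N2 xN ox; apply/eqP/eqP => [o3|o3].
  have := morph_order [morphism of coset N] xN; rewrite /= o3.
  by move: ox; rewrite !inE => /or3P[] /eqP ->.
have := morph_order [morphism of coset N] xN; rewrite /= o3.
rewrite dvdn_divisors // !inE => /orP[]/eqP // /eqP; rewrite order_eq1 => /eqP/coset_idr => /(_ xN).
by move/(mem_p_elt N2); rewrite /p_elt o3.
Qed.

(** The map [g] sends [x] to the vector whose transvection is the image of [x]. As [phi] is
    injective and a transvection determines its vector, its fibres are the sets [D :&: d *: N]. *)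
Lemma orthogonal_type_fibers (gT : finGroupType) (h m : nat) (eps : int)
    (G : {group gT}) (D : {set gT}) :
  orthogonal_type h m eps G D ->
  exists (f : {skew_symmetric 'rV['F_2]_(2 * m)}) (q : 'rV['F_2]_(2 * m) -> 'F_2)
      (g : gT -> 'rV['F_2]_(2 * m)),
    [/\ is_psymplectic f /\ quadratic_form_for f q, quadratic_type q m eps,
        {in D, forall x, g x \in nonsingular_vectors q},
        {in D &, forall x y, diagram x y = nonorthogonal f (g x) (g y)} &
        {in nonsingular_vectors q, forall v, #|[set x in D | g x == v]| = (2 ^ h)%N}].
Proof.
case=> [[DG D2 _ DD] _ [f [q [fS qf qT [N [nNG N2 DN [phi [isophi phiD]]]]]]]].
have /isomP[injphi _] := isophi.
have GN := normal_norm nNG.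
have DNN x : x \in D -> x \in 'N(N)%g by move=> xD; apply: (subsetP GN); apply: (subsetP DG).
have cG x : x \in D -> coset N x \in (G / N)%g.
  by move=> xD; apply: mem_quotient; apply: (subsetP DG).
pose S := nonsingular_vectors q.
pose T := transvection fS qf.
(* The default 0 never occurs on [D], by [gP]. *)
pose g x := odflt 0 [pick v in S | phi (coset N x) == T v].
have gP x : x \in D -> g x \in S /\ phi (coset N x) = T (g x).
  move=> xD; rewrite /g; case: pickP => [v /andP[vS /eqP ->] //|noT].
  have : phi (coset N x) \in transvections f q.
    by rewrite -phiD mem_morphim ?cG //; apply: mem_morphim => //; apply: DNN.
  rewrite (transvectionsE fS qf) => /imsetP[v vS E].
  by have := noT v; rewrite /= vS E eqxx.
exists f, q, g; split=> //.
- by move=> x /gP[].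
- move=> x y xD yD; have [gx Ex] := gP x xD; have [gy Ey] := gP y yD.
  rewrite -(order_transvection_mul fS qf gx gy) -/(T _) -/(T _) -Ex -Ey.
  rewrite -morphM ?cG // order_injm ?groupM ?cG // -morphM ?DNN //.
  by rewrite order3_quotient ?groupM ?DNN ?DD.
move=> v vS.
have : T v \in transvections f q by rewrite (transvectionsE fS qf); apply: imset_f.
rewrite -phiD => /morphimP[_ _ /morphimP[d dN dD ->] E].
rewrite -(DN d dD); apply: eq_card => x; rewrite !inE.
case xD: (x \in D) => //=.
have [gx Ex] := gP x xD.
rewrite -(norm_rlcoset dN); apply/eqP/idP => [gv|/rcoset_kercosetP xd].
  apply/rcoset_kercosetP => //; first exact: DNN.
  by apply: (injmP injphi); rewrite ?cG // Ex gv E.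
apply: (transvection_inj (f_sympl := fS) (qf := qf) gx vS); rewrite -/(T _) -/(T _) -Ex E.
by congr (phi _); apply: xd => //; apply: DNN.
Qed.

(** * Multiplicities and the final spectrum *)

Lemma prod_XsubC_nseq (R : nzRingType) (k : nat) (a : R) :
  \prod_(x <- nseq k a) ('X - x%:P) = ('X - a%:P) ^+ k.
Proof. by rewrite big_nseq iter_mulr_1. Qed.

Theorem proposition6p15 (gT : finGroupType) (G : {group gT}) (D : {set gT})
    (h m : nat) (eps : int)
    (m_ge1 : (1 <= m)%N)
    (eps_sign : eps = 1 \/ eps = -1)
    (GD_type : orthogonal_type h m eps G D) :
  #|D|%:Z = 2 ^+ h * (2 ^+ (2 * m - 1) - eps * 2 ^+ (m - 1)) /\
  exists k c1 c2 c0 : nat,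
    [/\ k%:Z = 2 ^+ h * (2 ^+ (2 * m - 2) - eps * 2 ^+ (m - 1)),
        c1%:R = (2 ^+ m - eps%:~R) * (2 ^+ (m - 1) - eps%:~R) / 3 :> rat,
        c2%:R = (2 ^+ (2 * m) - 4) / 3 :> rat,
        regular_graph (@diagram gT) D k &
        has_spectrum (adjacency (@diagram gT) D)
          (k%:R
           :: nseq c1 (eps%:~R * 2 ^ (h%:Z + m%:Z - 1))
           ++ nseq c2 (- eps%:~R * 2 ^ (h%:Z + m%:Z - 2))
           ++ nseq c0 0)].
Proof.
(* Lowering [m] by one removes the truncated subtractions; [p = 2 ^ m] below is [2 ^ (m - 1)] in the
   statement. *)
case: m m_ge1 GD_type => // m _ GD_type.
have [f [q [g [[fS qf] qT gS ge fib]]]] := orthogonal_type_fibers GD_type.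
have gaussE := q_gauss_sum_type (ltn0Sn m) fS qf qT.
clear GD_type qT; set S := nonsingular_vectors q in gS fib *.
have -> : (2 * m.+1 - 1 = (2 * m).+1)%N by rewrite mulnS addSn subn1.
have -> : (2 * m.+1 - 2 = 2 * m)%N by rewrite mulnS addKn.
have -> : (2 * m.+1 = (2 * m).+2)%N by rewrite mulnS.
rewrite subSS subn0.
pose p : int := 2 ^+ m.
have p_gt0 : p > 0 by rewrite exprn_gt0.
have eps2 : eps * eps = 1 by case: eps_sign => ->.
pose eC : algC := eps%:~R.
pose pC : algC := p%:~R.
have pCE : pC = 2 ^+ m by rewrite /pC rmorphXn.
have pC0 : pC != 0 by rewrite pCE expf_neq0 ?pnatr_eq0.
have eC2 : eC * eC = 1 by rewrite -intrM eps2.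
have gE : q_gauss_sum q = eC * 2 * pC by rewrite gaussE exprS pCE mulrA.
have two2m : 2 ^+ (2 * m.+1) = 4 * pC ^+ 2 :> algC.
  by rewrite pCE mulnS exprD mulnC exprM -natrX.
have g2 : q_gauss_sum q ^+ 2 = 2 ^+ (2 * m.+1) :> algC.
  by rewrite two2m gE !exprMn [eC ^+ 2]expr2 eC2 mul1r -natrX.
have SC : #|S|%:R = 2 * pC ^+ 2 - eC * pC :> algC.
  apply: (mulIf (x := 2)); rewrite ?pnatr_eq0 // mulr_natr (card_nonsingular q).
  by rewrite two2m gE; ring.
have SE : #|S|%:Z = 2 * p ^+ 2 - eps * p.
  by apply: (intr_inj (R := algC)); rewrite -[LHS]/(#|S|%:R) SC /eC /pC; ring.
pose deg v := #|[set w in S | nonorthogonal f v w]|.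
have degC v : v \in S -> (deg v)%:R = pC ^+ 2 - eC * pC :> algC.
  move=> vS; apply: (mulIf (x := 4)); rewrite ?pnatr_eq0 // mulr_natr.
  by rewrite (degree_nonorthogonal fS qf vS) two2m gE; ring.
have degE v : v \in S -> (deg v)%:Z = p ^+ 2 - eps * p.
  move=> vS; apply: (intr_inj (R := algC)).
  by rewrite -[LHS]/((deg v)%:R) degC // /eC /pC; ring.
have [v0 v0S] : exists v0, v0 \in S.
  apply/card_gt0P; rewrite -ltz_nat SE.
  by have := p_gt0; case: eps_sign => ->; nia.
have cardD P : #|[set x in D | P (g x)]| = (2 ^ h * #|[set u in S | P u]|)%N.
  exact: card_partition_fibers.
have DS : #|D| = (2 ^ h * #|S|)%N.
  have cardT (T : finType) (A : {set T}) : #|[set x in A | true]| = #|A|.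
    by apply: eq_card => x; rewrite inE andbT.
  by have := cardD xpredT; rewrite !cardT.
have natX k : (2 ^ k)%N%:Z = 2 ^+ k by rewrite -natz natrX.
split; first by rewrite DS PoszM SE natX (exprS _ (2 * m)%N) [(2 * m)%N]mulnC exprM.
have [b [d [bd rs chB]]] := char_poly_nonorthogonal fS qf (2 ^ h) g2.
(* Two linear equations determine [b] and [d]: their sum is [#|S|], and the trace relation divided
   by [2 ^ h * p * eps / 2] yields [2 b - d]. *)
have bdZ : (3 * b)%:Z = (2 * p - eps) * (p - eps) /\ (3 * d)%:Z = 4 * p ^+ 2 - 1.
  have eC0 : eC != 0 by rewrite intr_eq0; case: eps_sign => ->.
  have c0 : (2 ^ h)%:R != 0 :> algC by rewrite natrX expf_neq0 // pnatr_eq0.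
  have bdC : b%:R + d%:R = 2 * pC ^+ 2 - eC * pC :> algC by rewrite -natrD bd.
  have dif : 2 * b%:R - d%:R = 1 - 2 * eC * pC.
    have k0 : (2 ^ h)%:R * pC * eC / 2 != 0 by rewrite !mulf_neq0 // invr_eq0 pnatr_eq0.
    apply: (mulfI k0); move: rs; rewrite SC gE => rs.
    transitivity (- ((2 ^ h)%:R / 2 * (2 * pC ^+ 2 - eC * pC))).
      by rewrite -rs; field.
    transitivity ((2 ^ h)%:R / 2 * (pC * eC - 2 * pC ^+ 2 * (eC * eC))); last by field.
    by rewrite eC2; ring.
  split; apply: (intr_inj (R := algC)).
    rewrite -[LHS]/((3 * b)%:R) natrM.
    transitivity ((b%:R + d%:R) + (2 * b%:R - d%:R) : algC); first by ring.
    transitivity (2 * pC ^+ 2 - 3 * eC * pC + eC * eC).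
      by rewrite bdC dif eC2; ring.
    by rewrite /pC /eC; ring.
  rewrite -[LHS]/((3 * d)%:R) natrM.
  transitivity (2 * (b%:R + d%:R) - (2 * b%:R - d%:R) : algC); first by ring.
  by rewrite bdC dif /pC /eC; ring.
have pQ : p%:~R = 2 ^+ m :> rat by rewrite rmorphXn.
(* One of the [d] copies of [s] has moved to the degree, so the multiplicity sought is [d - 1]. *)
have d_gt0 : (0 < d)%N by have := bdZ.2; have := p_gt0; nia.
case: d d_gt0 bd rs chB bdZ => // d _ bd rs chB [bZ dZ].
exists (2 ^ h * deg v0)%N, b, d, (#|D| - #|S|)%N.
split.
- by rewrite PoszM degE // natX [(2 * m)%N]mulnC exprM.
- apply: (mulIf (x := 3)); rewrite ?pnatr_eq0 // divfK ?pnatr_eq0 //.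
  transitivity ((3 * b)%N%:Z%:~R : rat); first by rewrite -[RHS]/((3 * b)%:R) natrM mulrC.
  by rewrite bZ exprS -pQ; ring.
- apply: (mulIf (x := 3)); rewrite ?pnatr_eq0 // divfK ?pnatr_eq0 //.
  transitivity ((3 * d.+1)%N%:Z%:~R - 3 : rat).
    by rewrite -[X in X - _]/((3 * d.+1)%:R) natrM; ring.
  by rewrite dZ !exprS [(2 * m)%N]mulnC exprM -pQ; ring.
- move=> x xD; have gxS := gS x xD.
  rewrite (eq_card (B := [set y in D | nonorthogonal f (g x) (g y)])) => [|y].
    rewrite (cardD (nonorthogonal f (g x))) -/(deg _); congr (_ * _)%N.
    by case: (etrans (degE _ gxS) (esym (degE _ v0S))).
  by rewrite !inE; case yD: (y \in D) => //=; rewrite -ge.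
have two0 : 2 != 0 :> algC by rewrite pnatr_eq0.
have twoE : 2 ^ (h%:Z + m%:Z) = (2 ^ h)%:R * pC.
  by rewrite pCE natrX -exprD -PoszD exprnP.
have rE : eps%:~R * 2 ^ (h%:Z + m.+1%:Z - 1) = (2 ^ h)%:R / 2 * q_gauss_sum q.
  have -> : h%:Z + m.+1%:Z - 1 = h%:Z + m%:Z by rewrite -addn1 PoszD; ring.
  by rewrite twoE gE /eC; field.
(* This exponent is -1 when [h = 0] and the shifted [m] is 0, hence the integer powers; the
   multiplicity is then 0. *)
have sE : - eps%:~R * 2 ^ (h%:Z + m.+1%:Z - 2) = - ((2 ^ h)%:R / 4 * q_gauss_sum q).
  have -> : h%:Z + m.+1%:Z - 2 = h%:Z + m%:Z + (-1) by rewrite -addn1 PoszD; ring.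
  by rewrite expfzDr // twoE exprN1 gE /eC; field.
(* The moved eigenvalue of the all-one vector is the degree. *)
have kE : (2 ^ h * deg v0)%:R =
    - ((2 ^ h)%:R / 4 * q_gauss_sum q) + (2 ^ h)%:R / 2 * #|S|%:R :> algC.
  by rewrite natrM degC // SC gE; field.
rewrite /has_spectrum big_cons !big_cat /= !prod_XsubC_nseq rE sE kE.
move: chB; set s := - (_ / 4 * _); set r := _ / 2 * q_gauss_sum q; set k := s + _ => chB.
have {}chB : char_poly ((2 ^ h)%:R *: adjacency (nonorthogonal f) S) =
    ('X - k%:P) * (('X - r%:P) ^+ b * ('X - s%:P) ^+ d).
  apply: (mulfI (x := 'X - s%:P)); first by rewrite polyXsubC_eq0.
  by rewrite chB exprS; ring.
apply: (mulfI (x := 'X^#|S|)); first by rewrite expf_neq0 // polyX_eq0.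
rewrite (char_poly_adjacency_fibers gS ge fib) chB subr0.
have SD : (#|S| <= #|D|)%N by rewrite DS leq_pmull // expn_gt0.
have -> : 'X^#|D| = 'X^#|S| * 'X^(#|D| - #|S|) :> {poly algC} by rewrite -exprD subnKC.
by rewrite -mulrA; congr (_ * _); rewrite mulrC -!mulrA.
Qed.
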